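(* Hamiltonian actions of an exact DGLA of degree 2, with corresponding Courant algebra $p\colon\mathfrak a\to\mathfrak g$ (and $\mathfrak h=\ker p$), on an exact Courant algebroid $E\to M$ are equivalent to extended actions $\Psi\colon\mathfrak a\to\Gamma(E)$ with momentum map $\mu\colon M\to\mathfrak h^*$ satisfying the additional property that $$\mu^*([\![a,a]\!])=\tfrac12\langle\Psi(a),\Psi(a)\rangle,\qquad\forall a\in\mathfrak a,$$ where $(\mu^* h)(x)=\langle\mu(x),h\rangle$ for $h\in\mathfrak h$, $x\in M$.
   Context: Manifolds, vector bundles and vector spaces are smooth/real. **Courant algebroids.** A Courant algebroid is a vector bundle $E\to M$ with a fiberwise symmetric non-degenerate form $\langle\cdot,\cdot\rangle$, a bundle map $\rho\colon E\to TM$ and a bilinear bracket on $\Gamma(E)$ with: $[\![e_1,[\![e_2,e_3]\!]]\!]=[\![[\![e_1,e_2]\!],e_3]\!]+[\![e_2,[\![e_1,e_3]\!]]\!]$; $[\![e_1,fe_2]\!]=f[\![e_1,e_2]\!]+(\mathcal L_{\rho(e_1)}f)e_2$; $\mathcal L_{\rho(e_1)}\langle e_2,e_3\rangle=\langle[\![e_1,e_2]\!],e_3\rangle+\langle e_2,[\![e_1,e_3]\!]\rangle$; $\rho([\![e_1,e_2]\!])=[\rho(e_1),\rho(e_2)]$; $\langle e_1,[\![e_2,e_2]\!]\rangle=\frac12\mathcal L_{\rho(e_1)}\langle e_2,e_2\rangle$. $\rho^*\colon T^*M\to E$ is the dual of $\rho$ (using $E\cong E^*$). $E$ is exact if $0\to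 T^*M\xrightarrow{\rho^*}E\xrightarrow{\rho}TM\to0$ is exact; then $\Omega^1(M)$ is viewed inside $\Gamma(E)$ via $\rho^*$. $\mathbb A_E$ is the Atiyah algebroid: sections are pairs $(X,D)$, $X$ a vector field (symbol), $D\colon\Gamma(E)\to\Gamma(E)$ $\mathbb R$-linear with $D(fe)=(\mathcal L_Xf)e+fD(e)$, $\mathcal L_X\langle e,e'\rangle=\langle De,e'\rangle+\langle e,De'\rangle$, with commutator bracket. **Exact DGLAs and Courant algebras.** A DGLA of degree 2 is $(\mathfrak g,\mathfrak a,\mathfrak h,\delta,\varpi)$: a Lie algebra $\mathfrak g$, $\mathfrak g$-modules $\mathfrak a,\mathfrak h$, a $\mathfrak g$-equivariant symmetric bilinear map $\varpi\colon\mathfrak a\otimes\mathfrak a\to\mathfrak h$, and $\mathfrak g$-equivariant maps $\mathfrak h\xrightarrow{\delta}\mathfrak a\xrightarrow{\delta}\mathfrak g$ (adjoint action on $\mathfrak g$), $\delta^2=0$, with $\delta\varpi(a_1,a_2)=(\delta a_1)\cdot a_2+(\delta a_2)\cdot a_1$ and $(\delta a)\cdot h=\varpi(a,\delta h)$. It is exact if $0\to\mathfrak h\to\mathfrak a\to\mathfrak g\to0$ is exact. The corresponding (exact) Courant algebra is $p=\delta\colon\mathfrak a\to\mathfrak g$ with bracket $[\![a_1,a_2]\!]=\delta a_1\cdot a_2$ on $\mathfrak a$; $\mathfrak h$ is identified with $\ker p$. (One has $[\![a,a]\!]\in\mathfrak h$.) **Hamiltonian action** of $(\mathfrak g,\mathfrak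 a,\mathfrak h,\delta,\varpi)$ on $E$: a Lie algebra morphism $\varphi\colon\mathfrak g\to\Gamma(\mathbb A_E)$, written $\varphi(u)(e)=u\cdot e$ (inducing a $\mathfrak g$-action on $M$ through symbols), and $\mathfrak g$-equivariant maps $\mu\colon M\to\mathfrak h^*$ and $\varrho\colon\mathfrak a\to\Gamma(E)$ with $\mu^*(\varpi(a_1,a_2))=\langle\varrho(a_1),\varrho(a_2)\rangle$; $\varrho(\delta h)=\rho^*(d(\mu^*h))$; $(\delta a)\cdot e=[\![\varrho(a),e]\!]$; $u\cdot[\![e_1,e_2]\!]=[\![u\cdot e_1,e_2]\!]+[\![e_1,u\cdot e_2]\!]$. **Extended actions.** An extended action of an exact Courant algebra $\mathfrak a\to\mathfrak g$ on an exact Courant algebroid $E\to M$ is given by bracket-preserving maps $\Psi\colon\mathfrak a\to\Gamma(E)$ and $\psi\colon\mathfrak g\to\Gamma(TM)$ with $\rho\circ\Psi=\psi\circ p$ and $\Psi(\mathfrak h)\subseteq\Omega^1_{cl}(M)$ (closed 1-forms). A momentum map for it is a $\mathfrak g$-equivariant map $\mu\colon M\to\mathfrak h^*$ such that $\Psi(h)=\rho^*(d(\mu^*h))$ for all $h\in\mathfrak h$. **The equivalence** is given by $\Psi=\varrho$ with the same map $\mu$ (with $\varphi$ determined by $\varphi(\delta a)=[\![\Psi(a),\cdot]\!]$). *)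

(* Defs.v *)
From HB Require Import structures.
From mathcomp Require Import all_boot all_order all_algebra.
From mathcomp Require Import all_classical all_reals all_analysis.
From mathcomp Require Import ring.

Set Implicit Arguments.
Unset Strict Implicit.
Unset Printing Implicit Defensive.

Import Order.TTheory GRing.Theory Num.Theory.
Import numFieldNormedType.Exports.

Local Open Scope classical_set_scope.
Local Open Scope ring_scope.

Section Euclidean.
Variables (R : realType) (n : nat).
Implicit Types (O : set 'rV[R]_n) (f g : 'rV[R]_n -> R) (i : 'I_n).

Definition partial i f (x : 'rV[R]_n) : R := 'D_(delta_mx 0 i) (f : _ -> R^o) x.

(* Only meant for open O; the values of f outside O are then irrelevant. *)
Fixpoint Ck_on (k : nat) O f : Prop :=
  (forall x, O x -> {for x, continuous f}) /\
  match k with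
  | 0 => True
  | k'.+1 => forall i,
      (forall x, O x -> derivable (f : _ -> R^o) x (delta_mx 0 i)) /\
      Ck_on k' O (partial i f)
  end.

Definition Cinf_on O f : Prop := forall k, Ck_on k O f.

Lemma Ck_onS k O f : Ck_on k.+1 O f -> Ck_on k O f.
Proof.
elim: k f => [|k IH] f [cf H]; first by split.
by split=> // i; have [Hd Hk] := H i; split=> //; apply: IH.
Qed.

Lemma Ck_on_sub k O O' f : O' `<=` O -> Ck_on k O f -> Ck_on k O' f.
Proof.
move=> s; elim: k f => [|k IH] f [cf H]; split=> //; try by move=> x /s /cf.
by move=> i; have [Hd Hk] := H i; split; [move=> x /s /Hd|exact: IH].
Qed.

Lemma near_open O (x : 'rV[R]_n) f g :
  open O -> O x -> (forall y, O y -> f y = g y) -> \near x, f x = g x.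
Proof.
move=> oO Ox e; near=> y; apply: e; near: y; exact: open_nbhs_nbhs.
Unshelve. all: by end_near. Qed.

Lemma continuous_eq_open O (x : 'rV[R]_n) f g :
  open O -> O x -> (forall y, O y -> f y = g y) ->
  {for x, continuous f} -> {for x, continuous g}.
Proof.
move=> oO Ox e cf; rewrite /prop_for /continuous_at -(e _ Ox).
apply: cvg_trans cf.
exact: (@near_eq_cvg _ _ _ (nbhs_filter x) _ _ (near_open oO Ox e)).
Qed.

Lemma Ck_on_eq k O f g : open O -> (forall x, O x -> f x = g x) ->
  Ck_on k O f -> Ck_on k O g.
Proof.
move=> oO; elim: k f g => [|k IH] f g e [cf H]; split=> //.
- by move=> x Ox; exact: (continuous_eq_open oO Ox e (cf _ Ox)).
- by move=> x Ox; exact: (continuous_eq_open oO Ox e (cf _ Ox)).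
- move=> i; have [Hd Hk] := H i; split.
    move=> x Ox; apply: near_eq_derivable (Hd _ Ox); exact: (near_open oO Ox e).
  apply: IH Hk => x Ox; apply: near_eq_derive; exact: (near_open oO Ox e).
Qed.

Lemma Ck_on_cst k O (a : R) : Ck_on k O (fun=> a).
Proof.
elim: k a => [|k IH] a; split=> //.
- by move=> x _; exact: cst_continuous.
- by move=> x _; exact: cst_continuous.
- move=> i; split; first by move=> x _; exact: derivable_cst.
  have -> : partial i (fun=> a) = fun=> 0.
    by apply/funext => x; rewrite /partial derive_cst.
  exact: IH.
Qed.

Lemma Ck_onD k O f g : open O ->
  Ck_on k O f -> Ck_on k O g -> Ck_on k O (fun x => f x + g x).
Proof.
move=> oO; elim: k f g => [|k IH] f g [cf Hf] [cg Hg]; split=> //.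
- by move=> x Ox; exact: (continuousD (cf _ Ox) (cg _ Ox)).
- by move=> x Ox; exact: (continuousD (cf _ Ox) (cg _ Ox)).
- move=> i; have [df Kf] := Hf i; have [dg Kg] := Hg i; split.
    by move=> x Ox; apply: derivableD; [exact: df|exact: dg].
  apply: Ck_on_eq (IH _ _ Kf Kg) => // x Ox.
  by rewrite /partial -deriveD //; [exact: df|exact: dg].
Qed.

Lemma Ck_onM k O f g : open O ->
  Ck_on k O f -> Ck_on k O g -> Ck_on k O (fun x => f x * g x).
Proof.
move=> oO; elim: k f g => [|k IH] f g kf kg; have [cf Hf] := kf;
  have [cg Hg] := kg; split=> //.
- by move=> x Ox; exact: (continuousM (cf _ Ox) (cg _ Ox)).
- by move=> x Ox; exact: (continuousM (cf _ Ox) (cg _ Ox)).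
- move=> i; have [df Kf] := Hf i; have [dg Kg] := Hg i; split.
    by move=> x Ox; apply: derivableM; [exact: df|exact: dg].
  apply: (@Ck_on_eq k O (fun x => f x * partial i g x + g x * partial i f x)).
  + by [].
  + by move=> x Ox; rewrite /partial -deriveM //; [exact: df|exact: dg].
  + by apply: Ck_onD => //; apply: IH => //; exact: Ck_onS.
Qed.

End Euclidean.

Section Manifold.
Variable R : realType.

(* cfwd : cdom -> ccod is a homeomorphism with inverse cbwd; values elsewhere
   are irrelevant. *)
Record chart (T : topologicalType) (n : nat) := Chart {
  cdom : set T;
  ccod : set 'rV[R]_n;
  cfwd : T -> 'rV[R]_n;
  cbwd : 'rV[R]_n -> T;
  cdom_open : open cdom;
  ccod_open : open ccod;
  cfwd_cod : forall x, cdom x -> ccod (cfwd x);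
  cbwd_dom : forall y, ccod y -> cdom (cbwd y);
  cfwdK : forall x, cdom x -> cbwd (cfwd x) = x;
  cbwdK : forall y, ccod y -> cfwd (cbwd y) = y;
  cfwd_cont : forall x, cdom x -> {for x, continuous cfwd};
  cbwd_cont : forall y, ccod y -> {for y, continuous cbwd} }.

Record manifold := Manifold {
  mpt :> topologicalType;
  mdim : nat;
  matlas : set (chart mpt mdim);
  m_hausdorff : hausdorff_space mpt;
  m_second_countable : @second_countable mpt;
  m_cover : forall x : mpt, exists2 c, matlas c & cdom c x;
  m_compat : forall c d, matlas c -> matlas d -> forall j : 'I_mdim,
    Cinf_on [set y | ccod c y /\ cdom d (cbwd c y)]
            (fun y => cfwd d (cbwd c y) 0 j) }.

Variable M : manifold.
Implicit Types (U : set M) (f g : M -> R).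

Definition smooth_on U f : Prop := forall c, matlas c ->
  Cinf_on [set y | ccod c y /\ U (cbwd c y)] (fun y => f (cbwd c y)).

Definition smooth f : Prop := smooth_on setT f.

Lemma chart_image_open U (c : chart M (mdim M)) : open U ->
  open [set y | ccod c y /\ U (cbwd c y)].
Proof.
move=> oU; rewrite openE => y [cy Uy]; rewrite /interior.
have h1 : nbhs y (ccod c) by apply: open_nbhs_nbhs; split=> //; exact: ccod_open.
have h2 : nbhs y (cbwd c @^-1` U).
  by apply: (cbwd_cont cy); apply: open_nbhs_nbhs.
by apply: filterI.
Qed.

Lemma smooth_on_sub U U' f : U' `<=` U -> smooth_on U f -> smooth_on U' f.
Proof.
move=> s sf c cA k; apply: Ck_on_sub (sf c cA k) => y [? ?].
by split=> //; exact: s.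
Qed.

Lemma smooth_on_cst U (a : R) : smooth_on U (fun=> a).
Proof. by move=> c _ k; exact: Ck_on_cst. Qed.

Lemma smooth_onD U f g : open U ->
  smooth_on U f -> smooth_on U g -> smooth_on U (fun x => f x + g x).
Proof.
move=> oU sf sg c cA k; apply: Ck_onD; [exact: chart_image_open|
  exact: sf|exact: sg].
Qed.

Lemma smooth_onM U f g : open U ->
  smooth_on U f -> smooth_on U g -> smooth_on U (fun x => f x * g x).
Proof.
move=> oU sf sg c cA k; apply: Ck_onM; [exact: chart_image_open|
  exact: sf|exact: sg].
Qed.

Lemma smoothB f g : smooth f -> smooth g -> smooth (fun x => f x - g x).
Proof.
move=> sf sg; have -> : (fun x => f x - g x) = (fun x => f x + (-1) * g x).
  by apply/funext => x; rewrite mulN1r.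
apply: smooth_onD => //; first exact: openT.
by apply: smooth_onM => //; [exact: openT|exact: smooth_on_cst].
Qed.

Definition smooth_pred : pred (M -> R^o) := fun f => `[< smooth f >].

Record cinf := Cinf { cinf_fun :> M -> R^o; cinfP : cinf_fun \in smooth_pred }.

HB.instance Definition _ := [isSub for cinf_fun].
HB.instance Definition _ := [Choice of cinf by <:].

Lemma smooth_subring_closed : subring_closed smooth_pred.
Proof.
split.
- by apply/asboolP; exact: smooth_on_cst.
- by move=> f g /asboolP sf /asboolP sg; apply/asboolP; exact: smoothB.
- move=> f g /asboolP sf /asboolP sg; apply/asboolP.
  by apply: smooth_onM => //; exact: openT.
Qed.

HB.instance Definition _ :=
  GRing.isSubringClosed.Build (M -> R^o) smooth_pred smooth_subring_closed.
HB.instance Definition _ := 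
  GRing.SubChoice_isSubComPzRing.Build _ _ cinf (subringClosedP _).

Lemma smooth_scaler_closed : GRing.scaler_closed smooth_pred.
Proof.
move=> k f /asboolP sf; apply/asboolP.
by apply: smooth_onM => //; [exact: openT|exact: smooth_on_cst].
Qed.

HB.instance Definition _ :=
  GRing.isScaleClosed.Build R (M -> R^o) smooth_pred smooth_scaler_closed.
HB.instance Definition _ := [SubZmodule_isSubLmodule of cinf by <:].

End Manifold.

Section RawSections.
Variables (R : realType) (T : Type) (F : T -> lmodType R).

Definition rawsec : Type := forall x, F x.
Identity Coercion rawsec_fun : rawsec >-> Funclass.

HB.instance Definition _ := gen_eqMixin rawsec.
HB.instance Definition _ := gen_choiceMixin rawsec.

Let add (s t : rawsec) : rawsec := fun x => s x + t x.
Let opp (s : rawsec) : rawsec := fun x => - s x.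
Let scale (k : R) (s : rawsec) : rawsec := fun x => k *: s x.

Let addA : associative add.
Proof. by move=> s t u; apply/functional_extensionality_dep => x; exact: addrA. Qed.
Let addC : commutative add.
Proof. by move=> s t; apply/functional_extensionality_dep => x; exact: addrC. Qed.
Let add0 : left_id ((fun=> 0) : rawsec) add.
Proof. by move=> s; apply/functional_extensionality_dep => x; exact: add0r. Qed.
Let addN : left_inverse ((fun=> 0) : rawsec) opp add.
Proof. by move=> s; apply/functional_extensionality_dep => x; exact: addNr. Qed.

HB.instance Definition _ := GRing.isZmodule.Build rawsec addA addC add0 addN.

Let scaleA k l s : scale k (scale l s) = scale (k * l) s.
Proof. by apply/functional_extensionality_dep => x; exact: scalerA. Qed.
Let scale1 : left_id 1 scale.
Proof. by move=> s; apply/functional_extensionality_dep => x; exact: scale1r. Qed.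
Let scaleDr : right_distributive scale +%R.
Proof. by move=> k s t; apply/functional_extensionality_dep => x; exact: scalerDr. Qed.
Let scaleDl s : {morph scale^~ s : k l / k + l}.
Proof. by move=> k l; apply/functional_extensionality_dep => x; exact: scalerDl. Qed.

HB.instance Definition _ :=
  GRing.Zmodule_isLmodule.Build R rawsec scaleA scale1 scaleDr scaleDl.

End RawSections.

Section VectorBundle.
Variables (R : realType) (M : manifold R).

(* A rank r local trivialization of the family of vector spaces F; tfwd and tbwd
   are only meant over tdom. *)
Record trivialization (r : nat) (F : M -> lmodType R) := Trivialization {
  tdom : set M;
  tfwd : forall x, {linear F x -> 'rV[R]_r};
  tbwd : forall x, 'rV[R]_r -> F x;
  tdom_open : open tdom;
  tfwdK : forall x, tdom x -> cancel (tfwd x) (tbwd x);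
  tbwdK : forall x, tdom x -> cancel (tbwd x) (tfwd x) }.

Record vbundle := VBundle {
  fiber :> M -> lmodType R;
  brank : nat;
  batlas : set (trivialization brank fiber);
  b_cover : forall x, exists2 t, batlas t & tdom t x;
  b_compat : forall t u, batlas t -> batlas u -> forall i j : 'I_brank,
    smooth_on (tdom t `&` tdom u)
              (fun x => tfwd u x (tbwd t x (delta_mx 0 i)) 0 j) }.

Variable E : vbundle.

Definition smooth_section (s : forall x, E x) : Prop :=
  forall t, batlas t -> forall j : 'I_(brank E),
    smooth_on (tdom t) (fun x => tfwd t x (s x) 0 j).

Definition smooth_section_pred : pred (rawsec E) := fun s => `[< smooth_section s >].

Record Gamma := MkGamma {
  sec_fun :> rawsec E; sec_smooth : sec_fun \in smooth_section_pred }.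

HB.instance Definition _ := [isSub for sec_fun].
HB.instance Definition _ := [Choice of Gamma by <:].

Lemma smooth_section_submod : submod_closed smooth_section_pred.
Proof.
split.
  apply/asboolP => t tA j.
  have -> : (fun x => tfwd t x ((0 : rawsec E) x) 0 j) = fun=> 0.
    by apply/funext => x; rewrite linear0 mxE.
  exact: smooth_on_cst.
move=> k s s' /asboolP ss /asboolP ss'; apply/asboolP => t tA j.
have -> : (fun x => tfwd t x ((k *: s + s') x) 0 j) =
  (fun x => k * tfwd t x (s x) 0 j + tfwd t x (s' x) 0 j).
  by apply/funext => x; rewrite linearP !mxE.
have oU := tdom_open t.
apply: smooth_onD => //; last exact: ss'.
by apply: smooth_onM => //; [exact: smooth_on_cst|exact: ss].
Qed.

HB.instance Definition _ := GRing.isSubmodClosed.Build R (rawsec E)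
  smooth_section_pred smooth_section_submod.
HB.instance Definition _ := [SubChoice_isSubLmodule of Gamma by <:].

Lemma smooth_sectionM (f : cinf M) (s : Gamma) :
  ((fun x => f x *: s x) : rawsec E) \in smooth_section_pred.
Proof.
apply/asboolP => t tA j.
have -> : (fun x => tfwd t x (f x *: s x) 0 j) =
          (fun x => f x * tfwd t x (s x) 0 j).
  by apply/funext => x; rewrite linearZ !mxE.
apply: smooth_onM; first exact: tdom_open.
  by apply: (@smooth_on_sub _ _ setT) => //; apply/asboolP; exact: cinfP.
by have /asboolP := sec_smooth s; exact.
Qed.

Definition fscale (f : cinf M) (s : Gamma) : Gamma := MkGamma (smooth_sectionM f s).

End VectorBundle.

Section Tangent.
Variables (R : realType) (M : manifold R).
Implicit Types (x : M) (f g : cinf M).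

(* T_x M is the space of derivations of C^oo(M) at x. *)
Definition derivation_at x : pred (cinf M -> R^o) := fun v =>
  `[< linear v /\ forall f g, v (f * g) = f x * v g + g x * v f >].

Record tangent x := Tangent {
  tvec :> cinf M -> R^o; tvecP : tvec \in derivation_at x }.

HB.instance Definition _ x := [isSub for @tvec x].
HB.instance Definition _ x := [Choice of tangent x by <:].

Lemma derivation_at_submod x : submod_closed (derivation_at x).
Proof.
split.
  apply/asboolP; split=> [k f g|f g] /=.
    by rewrite /GRing.zero /= scaler0 addr0.
  by rewrite /GRing.zero /= !mulr0 addr0.
move=> k v w /asboolP [lv dv] /asboolP [lw dw]; apply/asboolP; split=> [l f g|f g].
  rewrite !fctE lv lw !scalerDr !scalerA (mulrC k l) !addrA; congr (_ + _).
  by rewrite -!addrA; congr (_ + _); rewrite addrC.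
rewrite !fctE dv dw /GRing.scale /= !mulrDr !addrA.
rewrite !mulrA (mulrC k) (mulrC k (g x)).
by rewrite -!addrA; congr (_ + _); rewrite addrCA.
Qed.

HB.instance Definition _ x := GRing.isSubmodClosed.Build R (cinf M -> R^o)
  (derivation_at x) (derivation_at_submod x).
HB.instance Definition _ x := [SubChoice_isSubLmodule of tangent x by <:].

(* A vector field X is smooth iff X f is smooth for every smooth f. *)
Definition smooth_vf_pred : pred (rawsec (fun x : M => tangent x : lmodType R)) :=
  fun X => `[< forall f, smooth (fun x => X x f) >].

Record vfield := VField {
  vf_fun :> rawsec (fun x : M => tangent x : lmodType R);
  vf_smooth : vf_fun \in smooth_vf_pred }.

HB.instance Definition _ := [isSub for vf_fun].
HB.instance Definition _ := [Choice of vfield by <:].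

Lemma smooth_vf_submod : submod_closed smooth_vf_pred.
Proof.
split; first by apply/asboolP => f; exact: smooth_on_cst.
move=> k X Y /asboolP sX /asboolP sY; apply/asboolP => f.
apply: smooth_onD => //; [exact: openT| |exact: sY].
by apply: smooth_onM; [exact: openT|exact: smooth_on_cst|exact: sX].
Qed.

HB.instance Definition _ := GRing.isSubmodClosed.Build R _
  smooth_vf_pred smooth_vf_submod.
HB.instance Definition _ := [SubChoice_isSubLmodule of vfield by <:].

Lemma lieDP (X : vfield) f : (fun x => X x f) \in @smooth_pred R M.
Proof. by apply/asboolP; have /asboolP := vf_smooth X; exact. Qed.

Definition lieD (X : vfield) f : cinf M := Cinf (lieDP X f).

Lemma tvec_linear x (v : tangent x) : linear v.
Proof. by have /asboolP [] := tvecP v. Qed.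

Lemma tvecM x (v : tangent x) f g : v (f * g) = f x * v g + g x * v f.
Proof. by have /asboolP [] := tvecP v. Qed.

Lemma lieD_linear X : linear (lieD X).
Proof. by move=> k f g; apply/val_inj/funext => x; exact: tvec_linear. Qed.

Lemma lieDM X f g : lieD X (f * g) = f * lieD X g + g * lieD X f.
Proof. by apply/val_inj/funext => x; exact: tvecM. Qed.

Lemma vbracket_atP (X Y : vfield) x :
  (fun f => X x (lieD Y f) - Y x (lieD X f)) \in derivation_at x.
Proof.
apply/asboolP; split=> [k f g|f g].
  rewrite !lieD_linear !tvec_linear scalerBr opprD !addrA; congr (_ - _).
  by rewrite -!addrA; congr (_ + _); rewrite addrC.
have tvecD (v : tangent x) a b : v (a + b) = v a + v b.
  by have := tvec_linear v 1 a b; rewrite !scale1r.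
rewrite !lieDM !tvecD !tvecM /= !mulrBr.
rewrite /GRing.scale /=. ring.
Qed.

Definition vbracket_at (X Y : vfield) x : tangent x := Tangent (vbracket_atP X Y x).

Lemma vbracketP (X Y : vfield) : vbracket_at X Y \in smooth_vf_pred.
Proof.
apply/asboolP => f.
by apply: smoothB; apply/asboolP; exact: lieDP.
Qed.

(* Lie bracket of vector fields: [X, Y] f = X (Y f) - Y (X f). *)
Definition vbracket (X Y : vfield) : vfield := VField (vbracketP X Y).

(* Smoothness of a 1-form is tested on vector fields, as that of a vector
   field is tested on functions. *)
Record oneform := OneForm {
  form_fun :> forall x, {linear tangent x -> R^o};
  form_smooth : forall X : vfield, (fun x => form_fun x (X x)) \in @smooth_pred R M }.

Definition form_eval (w : oneform) (X : vfield) : cinf M := Cinf (form_smooth w X).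

(* d w = 0, by the invariant formula
   dw (X, Y) = X (w Y) - Y (w X) - w [X, Y]. *)
Definition closed_form (w : oneform) : Prop := forall X Y : vfield,
  lieD X (form_eval w Y) - lieD Y (form_eval w X) - form_eval w (vbracket X Y) = 0.

Definition d_at f x (v : tangent x) : R^o := v f.

Lemma d_at_linear f x : linear (d_at f (x := x)).
Proof. by []. Qed.

HB.instance Definition _ f x := GRing.isLinear.Build R (tangent x) R^o *:%R
  (d_at f (x := x)) (d_at_linear f (x := x)).

Definition d_form f : oneform :=
  OneForm (form_fun := fun x => d_at f (x := x)) (fun X => lieDP X f).

End Tangent.

Definition is_bilinear (R : realType) (U V W : lmodType R) (b : U -> V -> W) :=
  (forall u, linear (b u)) /\ (forall v, linear (b^~ v)).

Section Courant.
Variables (R : realType) (M : manifold R).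

(* A vector bundle with a fibrewise metric and an anchor.  By locality, a
   fibrewise (bi)linear map is smooth iff it maps smooth sections to smooth
   functions, resp. vector fields
   (global sections suffice, by bump functions). *)
Record anchored_bundle := AnchoredBundle {
  abdl :> vbundle M;
  met : forall x, abdl x -> abdl x -> R^o;
  met_bilinear : forall x, is_bilinear (@met x);
  met_sym : forall x u v, @met x u v = @met x v u;
  met_nondeg : forall x u, (forall v, @met x u v = 0) -> u = 0;
  met_smooth : forall s t : Gamma abdl,
    (fun x => @met x (s x) (t x)) \in @smooth_pred R M;
  anchor : forall x, {linear abdl x -> tangent x};
  anchor_smooth : forall s : Gamma abdl,
    (fun x => anchor x (s x)) \in @smooth_vf_pred R M }.

Definition pairing (E : anchored_bundle) (s t : Gamma E) : cinf M :=
  Cinf (met_smooth s t).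

Definition anchor_sec (E : anchored_bundle) (s : Gamma E) : vfield M :=
  VField (anchor_smooth s).

Record courant := Courant {
  cbdl :> anchored_bundle;
  cbr : Gamma cbdl -> Gamma cbdl -> Gamma cbdl;
  cbr_bilinear : is_bilinear cbr;
  cbr_leibniz : forall e1 e2 e3,
    cbr e1 (cbr e2 e3) = cbr (cbr e1 e2) e3 + cbr e2 (cbr e1 e3);
  cbr_fscale : forall e1 f e2,
    cbr e1 (fscale f e2) =
      fscale f (cbr e1 e2) + fscale (lieD (anchor_sec e1) f) e2;
  cbr_met : forall e1 e2 e3,
    lieD (anchor_sec e1) (pairing e2 e3) =
      pairing (cbr e1 e2) e3 + pairing e2 (cbr e1 e3);
  cbr_anchor : forall e1 e2,
    anchor_sec (cbr e1 e2) = vbracket (anchor_sec e1) (anchor_sec e2);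
  cbr_diag : forall e1 e2,
    pairing e1 (cbr e2 e2) = 2^-1 *: lieD (anchor_sec e1) (pairing e2 e2) }.

(* rho^* : T^*_x M -> E_x, the dual of the anchor under E_x = E_x^*: the unique
   vector v with <v, e> = xi (rho e) for all e, see rho_dualP. *)
Definition rho_dual (E : anchored_bundle) (x : M)
    (xi : {linear tangent x -> R^o}) : E x :=
  xget 0 [set v : E x | forall e, met v e = xi (anchor E x e)].

Lemma rho_dualP (E : anchored_bundle) (x : M) (xi : {linear tangent x -> R^o}) e :
  met (rho_dual E xi) e = xi (anchor E x e).
Proof.
move: e; apply: (@xgetPex _ 0 [set v : E x | forall e, met v e = xi (anchor E x e)]).
have [t _ tx] := b_cover E x.
have bl := met_bilinear E x.
pose mr (u : E x) : {linear E x -> R^o} :=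
  HB.pack (met u : E x -> R^o) (GRing.isLinear.Build _ _ _ _ _ (bl.1 u)).
pose ml (v : E x) : {linear E x -> R^o} :=
  HB.pack ((@met E x)^~ v : E x -> R^o) (GRing.isLinear.Build _ _ _ _ _ (bl.2 v)).
have metZl c (u v : E x) : met (c *: u) v = c * met u v 
  by rewrite -[LHS]/(ml v _) linearZ.
pose b i : E x := tbwd t x (delta_mx 0 i).
have bE (u : E x) : u = \sum_i tfwd t x u 0 i *: b i.
  apply: (can_inj (tfwdK tx)); rewrite linear_sum /= [LHS]row_sum_delta.
  by apply: eq_bigr => i _; rewrite linearZ /= tbwdK.
pose G := \matrix_(i, j) met (b i) (b j).
pose L : 'rV[R]_(brank E) := \row_j xi (anchor E x (b j)).
have Gu : G \in unitmx.
  rewrite -row_free_unit -kermx_eq0; apply/eqP/row_matrixP => k.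
  rewrite row0; set w := row k _.
  have wG : w *m G = 0 by rewrite -row_mul mulmx_ker row0.
  suff u0 : tbwd t x w = 0 by rewrite -[w](tbwdK tx) u0 linear0.
  apply: met_nondeg => v; rewrite [X in met X _]bE [X in met _ X]bE.
  rewrite -[met _ _]/(mr _ _) linear_sum big1 // => j _; rewrite linearZ /=.
  rewrite -[met _ _]/(ml _ _) linear_sum /=.
  have /(congr1 (fun A : 'rV_ _ => A 0 j)) e := wG; rewrite !mxE in e.
  rewrite (_ : \sum_i _ = 0) ?scaler0 // -[RHS]e.
  by apply: eq_bigr => i _; rewrite metZl tbwdK // [G _ _]mxE.
exists (tbwd t x (L *m invmx G)) => e /=.
rewrite [in LHS](bE e) [in RHS](bE e) -[met _ _]/(mr _ _) !linear_sum.
apply: eq_bigr => j _; rewrite !linearZ /=; congr (_ *: _).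
rewrite (bE (tbwd t x _)) -[met _ _]/(ml _ _) linear_sum /= tbwdK //.
transitivity ((L *m invmx G *m G) 0 j); last by rewrite mulmxKV // mxE.
by rewrite [RHS]mxE; apply: eq_bigr => i _; rewrite metZl [G _ _]mxE.
Qed.

Definition exact_courant (E : courant) : Prop := forall x : M,
  [/\ forall xi eta : {linear tangent x -> R^o},
        rho_dual E xi = rho_dual E eta -> xi =1 eta,
      forall e : E x, anchor E x e = 0 <-> exists xi, rho_dual E xi = e &
      forall v : tangent x, exists e : E x, anchor E x e = v].

Definition is_rho_star (E : anchored_bundle) (w : oneform M) (s : Gamma E) : Prop :=
  forall x, s x = rho_dual E (w x).

(* Sections of the Atiyah algebroid A_E. *)
Record atiyah (E : courant) := Atiyah {
  symb : vfield M;
  aop : Gamma E -> Gamma E;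
  aop_linear : linear aop;
  aop_fscale : forall f e, aop (fscale f e) = fscale (lieD symb f) e + fscale f (aop e);
  aop_met : forall e e',
    lieD symb (pairing e e') = pairing (aop e) e' + pairing e (aop e') }.

(* A smooth map M -> V^*, for the weak smooth structure on the dual V^* (the
   usual one when V is finite-dimensional). *)
Record dual_map (V : lmodType R) := DualMap {
  dual_fun :> M -> {linear V -> R^o};
  dual_smooth : forall v, (fun x => dual_fun x v) \in @smooth_pred R M }.

Definition pull (V : lmodType R) (mu : dual_map V) (v : V) : cinf M :=
  Cinf (dual_smooth mu v).

End Courant.

Section DGLA.
Variable R : realType.

Definition is_lie_bracket (g : lmodType R) (br : g -> g -> g) : Prop :=
  [/\ is_bilinear br, forall u, br u u = 0 &
      forall u v w, br u (br v w) = br (br u v) w + br v (br u w)].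

Definition is_lie_module (g : lmodType R) (br : g -> g -> g)
    (V : lmodType R) (act : g -> V -> V) : Prop :=
  is_bilinear act /\
  forall u v x, act (br u v) x = act u (act v x) - act v (act u x).

Record dgla2 := Dgla2 {
  dg : lmodType R;
  da : lmodType R;
  dh : lmodType R;
  lbr : dg -> dg -> dg;
  acta : dg -> da -> da;
  acth : dg -> dh -> dh;
  delta_h : {linear dh -> da};
  delta_a : {linear da -> dg};
  vpi : da -> da -> dh;
  lbrP : is_lie_bracket lbr;
  actaP : is_lie_module lbr acta;
  acthP : is_lie_module lbr acth;
  vpi_bilinear : is_bilinear vpi;
  vpi_sym : forall a b, vpi a b = vpi b a;
  vpi_equiv : forall u a b, acth u (vpi a b) = vpi (acta u a) b + vpi a (acta u b);
  delta_h_equiv : forall u h, delta_h (acth u h) = acta u (delta_h h);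
  delta_a_equiv : forall u a, delta_a (acta u a) = lbr u (delta_a a);
  delta2 : forall h, delta_a (delta_h h) = 0;
  delta_vpi : forall a b,
    delta_h (vpi a b) = acta (delta_a a) b + acta (delta_a b) a;
  vpi_delta : forall a h, acth (delta_a a) h = vpi a (delta_h h) }.

End DGLA.

Arguments delta_h {R d}.
Arguments delta_a {R d}.

Definition exact_dgla (R : realType) (G : dgla2 R) : Prop :=
  [/\ injective (delta_h : dh G -> da G),
      forall a : da G, delta_a a = 0 <-> exists h, delta_h h = a &
      forall u : dg G, exists a, delta_a a = u].

(* The Courant algebra of G is p = delta_a : a -> g with this bracket;
   h is identified with ker p through delta_h. *)
Definition abr (R : realType) (G : dgla2 R) (a b : da G) : da G := acta (delta_a a) b.

Section Actions.
Variables (R : realType) (M : manifold R) (E : courant M) (G : dgla2 R).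
Implicit Types (u v : dg G) (a b : da G) (h : dh G) (e : Gamma E).

(* phi is a Lie algebra morphism for the commutator bracket of A_E. *)
Definition atiyah_morphism (phi : dg G -> atiyah E) : Prop :=
  [/\ linear (fun u => symb (phi u)),
      forall e, linear (fun u => aop (phi u) e),
      forall u v, symb (phi (lbr u v)) = vbracket (symb (phi u)) (symb (phi v)) &
      forall u v e, aop (phi (lbr u v)) e =
        aop (phi u) (aop (phi v) e) - aop (phi v) (aop (phi u) e)].

(* Infinitesimal equivariance of mu : M -> h^* for the action X of g on M by
   vector fields and the dual action on h^*. *)
Definition mu_equivariant (X : dg G -> vfield M) (mu : dual_map M (dh G)) : Prop :=
  forall u h, lieD (X u) (pull mu h) = pull mu (acth u h).

Record hamiltonian_action (phi : dg G -> atiyah E) (mu : dual_map M (dh G))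
    (vrho : da G -> Gamma E) : Prop := HamiltonianAction {
  ham_phi : atiyah_morphism phi;
  ham_mu_equiv : mu_equivariant (fun u => symb (phi u)) mu;
  ham_vrho_linear : linear vrho;
  ham_vrho_equiv : forall u a, vrho (acta u a) = aop (phi u) (vrho a);
  ham_vpi : forall a b, pull mu (vpi a b) = pairing (vrho a) (vrho b);
  ham_delta_h : forall h, is_rho_star (d_form (pull mu h)) (vrho (delta_h h));
  ham_delta_a : forall a e, aop (phi (delta_a a)) e = cbr (vrho a) e;
  ham_cbr : forall u e1 e2, aop (phi u) (cbr e1 e2) =
    cbr (aop (phi u) e1) e2 + cbr e1 (aop (phi u) e2) }.

Record extended_action (Psi : da G -> Gamma E) (psi : dg G -> vfield M) : Prop :=
  ExtendedAction {
  ext_Psi_linear : linear Psi;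
  ext_psi_linear : linear psi;
  ext_Psi_br : forall a b, Psi (abr a b) = cbr (Psi a) (Psi b);
  ext_psi_br : forall u v, psi (lbr u v) = vbracket (psi u) (psi v);
  ext_anchor : forall a, anchor_sec (Psi a) = psi (delta_a a);
  ext_closed : forall h, exists2 w : oneform M,
    closed_form w & is_rho_star w (Psi (delta_h h)) }.

Record momentum_map (Psi : da G -> Gamma E) (psi : dg G -> vfield M)
    (mu : dual_map M (dh G)) : Prop := MomentumMap {
  mom_equiv : mu_equivariant psi mu;
  mom_rho : forall h, is_rho_star (d_form (pull mu h)) (Psi (delta_h h)) }.

(* mu^* [[a, a]] = 1/2 <Psi a, Psi a>, where h is [[a, a]] seen as an element
   of ker p; it exists and is unique if G is exact. *)
Definition norm_condition (Psi : da G -> Gamma E) (mu : dual_map M (dh G)) : Prop :=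
  forall a h, delta_h h = abr a a ->
    pull mu h = 2^-1 *: pairing (Psi a) (Psi a).

End Actions.

(* Main.v *)
Require Import Defs.
From mathcomp Require Import all_boot all_order all_algebra.
From mathcomp Require Import all_classical all_reals all_analysis.
From mathcomp Require Import ring lra.

Set Implicit Arguments.
Unset Strict Implicit.
Unset Printing Implicit Defensive.

Import Order.TTheory GRing.Theory Num.Theory.
Import numFieldNormedType.Exports.

Local Open Scope classical_set_scope.
Local Open Scope ring_scope.

(* Going from an extended to a Hamiltonian action,
   [phi (delta_a a) := [[Psi a, -]]] is well defined because [ker delta_a] is the
   image of [delta_h], where the momentum condition makes [Psi (delta_h h)] an
   exact 1-form, and exact 1-forms act trivially by the bracket; the norm
   condition polarizes to the compatibility of [mu] with [vpi].  The anchor of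
   [Psi a] is the symbol of [phi (delta_a a)] because an operator determines its
   symbol through the Leibniz rule; this, and the non-degeneracy of the pairing on
   global sections, requires a section through every vector of [E], hence a bump
   function. *)

(** * The flat function exp(-1/x) and its derivatives *)

Section FlatExp.
Variable R : realType.
Implicit Types (p : {poly R}) (x : R).

(* Polynomials in 1/x make the family stable under derivation. *)
Definition flat_exp p x : R := if 0 < x then p.[x^-1] * expR (- x^-1) else 0.

Lemma flat_exp_le0 p x : x <= 0 -> flat_exp p x = 0.
Proof. by rewrite /flat_exp leNgt => /negbTE ->. Qed.

(** With t = 1/x > 0, the exponential series gives t^(i+1) <= (i+1)! exp t, hence t^i exp(-t) <=
    (i+1)! x for each monomial of [p]. *)
Lemma flat_exp_bound p : exists2 C, 0 <= C & forall x, `|flat_exp p x| <= C * `|x|.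
Proof.
exists (\sum_(i < size p) `|p`_i| * i.+1`!%:R).
  by apply: sumr_ge0 => i _; rewrite mulr_ge0.
move=> x; rewrite /flat_exp; case: ltP => [x0|_]; last first.
  by rewrite normr0 mulr_ge0 ?sumr_ge0 // => i _; rewrite mulr_ge0.
rewrite horner_coef !mulr_suml (gtr0_norm x0).
apply: le_trans (ler_norm_sum _ _ _) _; apply: ler_sum => i _.
have v0 : 0 < x^-1 by rewrite invr_gt0.
rewrite -!mulrA normrM ler_wpM2l //.
rewrite ger0_norm; last by rewrite mulr_ge0 ?expR_ge0 ?exprn_ge0 // ltW.
have le := expR_ge1Dxn i (ltW v0).
have {}le : x^-1 ^+ i.+1 <= i.+1`!%:R * expR x^-1.
  rewrite mulrC -ler_pdivrMr ?ltr0n ?fact_gt0 //.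
  by apply: le_trans le; rewrite lerDr.
rewrite expRN ler_pdivrMr ?expR_gt0 //.
rewrite mulrAC -ler_pdivrMr // -exprSr.
exact: le.
Qed.

(** With t = 1/x and dt/dx = -t^2, the derivative of p(t) exp(-t) is (p(t) - p'(t)) t^2 exp(-t). *)
Lemma flat_exp_derive_pos p x (x0 : 0 < x) :
  is_derive x 1 (flat_exp p) (flat_exp ((p - p^`()) * 'X^2) x).
Proof.
have E : \near x, p.[x^-1] * expR (- x^-1) = flat_exp p x.
  near=> y; rewrite /flat_exp ifT //; near: y; exact: lt_nbhsr.
apply: near_eq_is_derive E _.
have dV : is_derive x 1 (fun y : R => y^-1) (- x ^- 2).
  have := @is_deriveV R id x 1 1 (lt0r_neq0 x0) _.
  by rewrite scaler1; apply; exact: is_derive_id.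
have dp := @is_derive1_comp R (horner p) _ x _ _ (is_derive_poly p x^-1) dV.
have dN : is_derive x 1 (fun y : R => - y^-1) (x ^- 2).
  by rewrite -[x ^- 2]opprK; exact: is_deriveN.
have de := @is_derive1_comp R expR _ x _ _ (is_derive_expR _) dN.
have [dM eM] := is_deriveM dp de; apply: DeriveDef; first exact: dM.
apply: etrans eM _.
rewrite /flat_exp x0 !hornerE /= /GRing.scale /=; field; exact: lt0r_neq0.
Unshelve. all: by end_near. Qed.

Lemma flat_exp_derive p x :
  is_derive x 1 (flat_exp p) (flat_exp ((p - p^`()) * 'X^2) x).
Proof.
have [x0|x0|->] := ltgtP x 0; last 2 first.
- exact: flat_exp_derive_pos.
- rewrite [X in is_derive _ _ _ X]flat_exp_le0 //.
  have lim : h^-1 *: (((flat_exp p : R -> R^o) \o shift 0) (h *: (1:R))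
      - flat_exp p 0) @[h --> 0^'] --> (0 : R^o).
    have [C C0 HC] := flat_exp_bound (p * 'X).
    apply/cvgr0Pnorm_le => e e0.
    near=> h.
    rewrite /= addr0 [h *: 1]mulr1 [flat_exp p 0]flat_exp_le0 // subr0.
    (* Division by [h] multiplies the polynomial by ['X], so the difference quotient stays in the
       family and is O(|h|) by [flat_exp_bound]. *)
    have -> : h^-1 *: flat_exp p h = flat_exp (p * 'X) h.
      rewrite /flat_exp; case: ifP => _; last by rewrite scaler0.
      by rewrite hornerMX /GRing.scale /=; ring.
    apply: le_trans (HC h) _.
    (* The [+ 1] covers the case [C = 0]. *)
    have hC : `|h| <= e / (C + 1).
      near: h; apply: dnbhs0_le; rewrite divr_gt0 //; lra.
    apply: (@le_trans _ _ (C * (e / (C + 1)))); first exact: ler_wpM2l.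
    rewrite mulrA ler_pdivrMr; last lra.
    rewrite mulrC; nra.
  by apply: DeriveDef; [apply/cvg_ex; exists 0|apply/cvg_lim].
- rewrite [X in is_derive _ _ _ X]flat_exp_le0; last exact: ltW.
  apply: near_eq_is_derive (is_derive_cst (0 : R^o) x 1).
  near=> y; rewrite flat_exp_le0 //; near: y; exact: lt_le_nbhsl.
Unshelve. all: by end_near. Qed.
End FlatExp.

(** * Stability of [Ck_on] under composition, localization and sums *)

Section Smoothness.
Variables (R : realType) (n : nat).
Implicit Types (O : set 'rV[R]_n) (q : 'rV[R]_n -> R).

Lemma derive_along_line q (x v : 'rV[R]_n) :
  'D_v (q : _ -> R^o) x = 'D_1 (fun h : R => q (h *: v + x) : R^o) 0.
Proof.
rewrite /derive; set g1 := fun h => h^-1 *: _; set g2 := fun h => h^-1 *: _.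
suff -> : g1 = g2 by [].
by apply/funext => h; rewrite /g1 /g2 /= addr0 scale0r add0r [_%:A]mulr1.
Qed.

(** Since [q] is only derivable in the direction [v], the one-variable chain rule is applied on the
    line through [x] in that direction. *)
Lemma is_derive_comp1 (F : R -> R) q (x v : 'rV[R]_n) (a : R) :
  is_derive (q x) 1 F a -> derivable (q : _ -> R^o) x v ->
  is_derive x v (F \o q : _ -> R^o) (a * 'D_v (q : _ -> R^o) x).
Proof.
move=> dF dq.
pose g (h : R) := q (h *: v + x).
have g0 : g 0 = q x by rewrite /g scale0r add0r.
have dg : is_derive (0 : R) 1 (g : R -> R) ('D_v (q : _ -> R^o) x).
  apply: DeriveDef; first exact: (derivable1P (q : _ -> R^o) x v).1 dq.
  by rewrite derive_along_line.
rewrite -g0 in dF.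
have [dFg EFg] := is_derive1_comp dF dg.
apply: DeriveDef; first exact: (derivable1P (F \o q : _ -> R^o) x v).2 dFg.
by rewrite derive_along_line -EFg.
Qed.

(** Taking a whole sequence of successive derivatives lets the induction on [k] run: a partial
    derivative of [F m \o q] is [F m.+1 \o q] times one of [q]. *)
Lemma Ck_on_comp (F : nat -> R -> R) k m O q :
  (forall i (x : R), is_derive x 1 (F i) (F i.+1 x)) -> open O ->
  Ck_on k O q -> Ck_on k O (F m \o q).
Proof.
move=> dF oO; elim: k m q => [|k IH] m q kq; have [cq Hq] := kq.
  split=> // x Ox; apply: continuous_comp; first exact: cq.
  apply/differentiable_continuous/derivable1_diffP.
  by have [] := dF m (q x).
split=> [x Ox|i].
  apply: continuous_comp; first exact: cq.
  apply/differentiable_continuous/derivable1_diffP.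
  by have [] := dF m (q x).
have [dq Kq] := Hq i.
have D x (Ox : O x) := is_derive_comp1 (dF m (q x)) (dq x Ox).
split; first by move=> x /D [].
apply: (@Ck_on_eq _ _ k O (fun x => (F m.+1 \o q) x * partial i q x)) => //.
  by move=> x /D [_ <-].
by apply: Ck_onM => //; apply: IH; exact: Ck_onS.
Qed.

(** [Ck_on] imposes conditions only at points of the set, on functions defined everywhere, so they
    can be gathered point by point. *)
Lemma Ck_on_local k O q :
  (forall x, O x -> exists2 V, V x & Ck_on k V q) -> Ck_on k O q.
Proof.
elim: k q => [|k IH] q loc.
  by split=> // x /loc [V Vx [c _]]; exact: c.
split=> [x /loc [V Vx [c _]]|i]; first exact: c.
split=> [x /loc [V Vx [_ H]]|]; first by have [d _] := H i; exact: d.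
by apply: IH => x /loc [V Vx [_ H]]; exists V => //; have [] := H i.
Qed.

Lemma Ck_on_sum k O (I : Type) (s : seq I) (q : I -> 'rV[R]_n -> R) :
  open O -> (forall i, Ck_on k O (q i)) ->
  Ck_on k O (fun x => \sum_(i <- s) q i x).
Proof.
move=> oO kq; elim: s => [|i s IH].
  rewrite (_ : (fun _ => _) = fun=> 0); first exact: Ck_on_cst.
  by apply/funext => x; rewrite big_nil.
rewrite (_ : (fun _ => _) = fun x => q i x + \sum_(i <- s) q i x).
  exact: Ck_onD.
by apply/funext => x; rewrite big_cons.
Qed.
End Smoothness.

(** * Bump functions, and sections with a prescribed value *)

Section BumpFunctions.
Variables (R : realType) (M : manifold R).
Implicit Types (U V K : set M) (f g : M -> R).

Lemma smooth_on_local U f :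
  (forall x, U x -> exists V g, [/\ open V, V x, smooth_on V g &
     forall y, V y -> g y = f y]) ->
  smooth_on U f.
Proof.
move=> loc c cA k; apply: Ck_on_local => y [cy Uy].
have [V [g [oV Vy sg gf]]] := loc _ Uy.
exists [set y | ccod c y /\ V (cbwd c y)] => //.
apply: (Ck_on_eq (chart_image_open oV)) (sg c cA k) => z [_ Vz]; exact: gf.
Qed.

Lemma smooth_on_sum U (I : Type) (s : seq I) (f : I -> M -> R) : open U ->
  (forall i, smooth_on U (f i)) -> smooth_on U (fun x => \sum_(i <- s) f i x).
Proof.
move=> oU sf c cA k; apply: Ck_on_sum; first exact: chart_image_open.
by move=> i; exact: sf.
Qed.

(** In a chart, exp(-1/q) with q = r^2 - |y - x0|^2 is extended by zero. The Hausdorff property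
    makes the compact set [K] closed, so the extension is smooth on two open sets that cover [M]:
    the chart domain and the complement of [K]. *)
Lemma bump_function U (x : M) : open U -> U x ->
  exists f K, [/\ smooth f, f x != 0, closed K, K `<=` U &
    forall y, ~ K y -> f y = 0].
Proof.
move=> oU Ux; have [c cA cx] := m_cover x.
set x0 := cfwd c x.
have cx0 : ccod c x0 by exact: cfwd_cod.
have /nbhs_ballP [e /= e0 eW] : \forall y \near x0, ccod c y /\ U (cbwd c y).
  apply: open_nbhs_nbhs; split; first exact: chart_image_open.
  by split=> //; rewrite /x0 cfwdK.
(* Halving puts the closed cube of half-side [r] inside the open sup-norm ball of radius [e]. *)
pose r := e / 2.
have r0 : 0 < r by rewrite divr_gt0.
pose Q := [set y : 'rV[R]_(mdim M) |
  forall j, [set` `[x0 0 j - r, x0 0 j + r]%R] (y 0 j)].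
have QW y : Q y -> ccod c y /\ U (cbwd c y).
  move=> Qy; apply: eW; split=> // i j; rewrite (ord1 i).
  have := Qy j; rewrite /= in_itv /= => /andP[a b].
  rewrite /ball /= ltr_norml /r in a b *; apply/andP; split; lra.
pose K := cbwd c @` Q.
have cK : closed K.
  apply: (compact_closed (@m_hausdorff _ M)); apply: continuous_compact.
    apply: continuous_in_subspaceT => y /set_mem /QW [cy _].
    exact: cbwd_cont.
  apply: (@rV_compact R _ (fun j => [set` `[x0 0 j - r, x0 0 j + r]%R])) => j.
  exact: segment_compact.
(* The Euclidean square norm is polynomial in the coordinates, unlike the sup norm; positivity of
   [q] still confines [y] to the cube [Q]. *)
pose q (y : 'rV[R]_(mdim M)) : R :=
  r ^+ 2 + \sum_(j <- enum 'I_(mdim M))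
    (- 1) * ((y 0 j - x0 0 j) * (y 0 j - x0 0 j)).
have qQ y : 0 < q y -> Q y.
  move=> qy j; rewrite /= in_itv /= -ler_distl.
  rewrite -(@ler_pXn2r _ 2) ?nnegrE ?normr_ge0 ?(ltW r0) //.
  rewrite real_normK ?num_real //.
  move: qy; rewrite /q big_enum /= (bigD1 j) //=.
  set s := \sum_(i | _) _.
  have s0 : s <= 0.
    by apply: sumr_le0 => i _; rewrite mulN1r oppr_le0 -expr2 sqr_ge0.
  rewrite -expr2; lra.
(* Successive derivatives of exp(-1/x), as given by [flat_exp_derive] from the polynomial 1. *)
pose F i := flat_exp (iter i (fun p : {poly R} => (p - p^`()) * 'X^2) 1).
pose f p := if `[< cdom c p >] then F 0%N (q (cfwd c p)) else 0.
have fK y : ~ K y -> f y = 0.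
  move=> nK; rewrite /f; case: asboolP => // cy.
  apply: flat_exp_le0; rewrite leNgt; apply/negP => /qQ Qy; apply: nK.
  by exists (cfwd c y) => //; exact: cfwdK.
have KU : K `<=` U by move=> _ [y /QW [_ ?] <-].
exists f, K; split=> //; last first.
  rewrite /f asboolT // /F /= /flat_exp.
  have -> : q (cfwd c x) = r ^+ 2.
    by rewrite /q big1 ?addr0 // => j _; rewrite subrr !mulr0.
  by rewrite exprn_gt0 // hornerC mul1r gt_eqF // expR_gt0.
apply: smooth_on_local => y _; have [cy|ncy] := pselect (cdom c y).
  exists (cdom c), (F 0%N \o (q \o cfwd c)); split=> //; first exact: cdom_open.
    move=> d dA k; have oC := @chart_image_open _ _ _ d (cdom_open c).
    have := @Ck_on_comp _ _ F k 0 [set y | ccod d y /\ cdom c (cbwd d y)]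
      (q \o cfwd c \o cbwd d); apply=> //.
      by move=> i z; exact: flat_exp_derive.
    apply: Ck_onD => //; first exact: Ck_on_cst.
    apply: Ck_on_sum => // j.
    have kj : Ck_on k [set y | ccod d y /\ cdom c (cbwd d y)]
        (fun y => cfwd c (cbwd d y) 0 j + (- x0 0 j)).
      apply: Ck_onD => //; last exact: Ck_on_cst.
      exact: m_compat.
    by apply: Ck_onM => //; [exact: Ck_on_cst|exact: Ck_onM].
  by move=> z cz; rewrite /f asboolT.
exists (~` K), (fun=> 0); split=> //; first exact: closed_openC.
- by move=> [z /QW [cz _] zy]; apply: ncy; rewrite -zy; exact: cbwd_dom.
- exact: smooth_on_cst.
- by move=> z /fK.
Qed.

End BumpFunctions.

(** The section with constant coordinates in a trivialization is cut off by a normalized bump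
    function. In another trivialization its coordinates are constant combinations of transition
    functions, times the bump. *)
Lemma section_through (R : realType) (M : manifold R) (E : vbundle M)
    (x : M) (v : E x) : exists s : Gamma E, s x = v.
Proof.
have [t tA tx] := b_cover E x.
have [f [K [sf fx cK Kt fK]]] := bump_function (tdom_open t) tx.
pose s : rawsec E := fun y => (f y / f x) *: tbwd t y (tfwd t x v).
suff sP : s \in @smooth_section_pred _ _ E.
  by exists (MkGamma sP); rewrite /= /s divff // scale1r tfwdK.
apply/asboolP => u uA j; apply: smooth_on_local => y uy.
have [ty|nty] := pselect (tdom t y); last first.
  exists (~` K), (fun=> 0); split=> //; first exact: closed_openC.
  - by move=> /Kt.
  - exact: smooth_on_cst.
  - by move=> z /fK fz; rewrite /s fz mul0r scale0r linear0 mxE.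
pose w := tfwd t x v.
exists (tdom t `&` tdom u), (fun y => f y * (f x)^-1 * \sum_(i <- enum 'I_(brank E))
  w 0 i * tfwd u y (tbwd t y (delta_mx 0 i)) 0 j).
have oV : open (tdom t `&` tdom u) by apply: openI; exact: tdom_open.
split=> //.
  apply: smooth_onM => //.
    apply: smooth_onM => //; last exact: smooth_on_cst.
    exact: smooth_on_sub sf.
  apply: smooth_on_sum => // i; apply: smooth_onM => //; first exact: smooth_on_cst.
  exact: b_compat.
move=> z [tz uz]; rewrite /s linearZ mxE; congr (_ * _).
have -> : tbwd t z (tfwd t x v) = \sum_i w 0 i *: tbwd t z (delta_mx 0 i).
  apply: (can_inj (tfwdK tz)); rewrite tbwdK // linear_sum /= [LHS]row_sum_delta.
  by apply: eq_bigr => i _; rewrite linearZ /= tbwdK.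
rewrite linear_sum summxE big_enum /=.
by apply: eq_bigr => i _; rewrite linearZ mxE.
Qed.

(** * Consequences of the Courant algebroid axioms *)

Section CourantAlgebroid.
Variables (R : realType) (M : manifold R) (E : courant M).
Implicit Types (e s : Gamma E) (f : cinf M).

Lemma pairingC s e : pairing s e = pairing e s.
Proof. by apply/val_inj/funext => x; exact: met_sym. Qed.

Lemma pairing_linear s : linear (pairing s : Gamma E -> cinf M).
Proof.
by move=> k e e'; apply/val_inj/funext => x; exact: (met_bilinear E x).1.
Qed.

Lemma pairingDr s e e' : pairing s (e + e') = pairing s e + pairing s e'.
Proof. by have := pairing_linear s 1 e e'; rewrite !scale1r. Qed.

Lemma pairingDl s s' e : pairing (s + s') e = pairing s e + pairing s' e.
Proof. by rewrite ![pairing _ e]pairingC pairingDr. Qed.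

Lemma pairing_nondeg s : (forall e, pairing s e = 0) -> s = 0.
Proof.
move=> s0; apply/val_inj/functional_extensionality_dep => x.
apply: met_nondeg => v; have [e <-] := section_through v.
exact: (congr1 (fun f : cinf M => f x) (s0 e)).
Qed.

Lemma lieDD (X : vfield M) f f' : lieD X (f + f') = lieD X f + lieD X f'.
Proof. by have := lieD_linear X 1 f f'; rewrite !scale1r. Qed.

Lemma cbrDl e1 e2 e : cbr (e1 + e2) e = cbr e1 e + cbr e2 e.
Proof. by have := (cbr_bilinear E).2 e 1 e1 e2; rewrite !scale1r. Qed.

Lemma cbrDr e e1 e2 : cbr e (e1 + e2) = cbr e e1 + cbr e e2.
Proof. by have := (cbr_bilinear E).1 e 1 e1 e2; rewrite !scale1r. Qed.

(** Polarization of [cbr_diag]: the two equal cross terms absorb the factor 1/2. *)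
Lemma cbr_sym e e1 e2 :
  pairing e (cbr e1 e2 + cbr e2 e1) = lieD (anchor_sec e) (pairing e1 e2).
Proof.
have := cbr_diag e (e1 + e2).
rewrite cbrDl !cbrDr !pairingDr !pairingDl !lieDD !cbr_diag.
rewrite (pairingC e2 e1) !scalerDr.
set a := _ *: lieD _ (pairing e1 e1); set b := _ *: lieD _ (pairing e2 e2).
set c := _ *: lieD _ (pairing e1 e2).
have cc : c + c = lieD (anchor_sec e) (pairing e1 e2).
  by rewrite /c -scalerDl -[X in X + X]mul1r -splitr scale1r.
rewrite -cc -!addrA => /addrI; rewrite !addrA => /addIr; exact.
Qed.

(* [rho^* df, e] = - i_(rho e) d(df) = 0. *)
Lemma cbr_exact_form f s e : is_rho_star (d_form f) s -> cbr s e = 0.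
Proof.
move=> sf.
have sE e' : pairing s e' = lieD (anchor_sec e') f.
  by apply/val_inj/funext => x; rewrite /= sf rho_dualP.
apply: pairing_nondeg => e'.
(* Invariance of the pairing gives rho(e) rho(e') f - [rho(e), rho(e')] f, that is, [[e, s]] = rho^*
   d(rho(e) f). *)
have es : pairing (cbr e s) e' = lieD (anchor_sec e') (lieD (anchor_sec e) f).
  have := cbr_met e s e'; rewrite !sE cbr_anchor => /eqP.
  rewrite -subr_eq => /eqP <-.
  by apply/val_inj/funext => x; rewrite /= opprB addrC subrK.
(* The symmetric part [[s, e]] + [[e, s]] has the same pairing with [e'], so nothing is left for
   [[s, e]]. *)
have := cbr_sym e' s e; rewrite pairingDr sE ![pairing e' _]pairingC es.
by rewrite -[RHS]add0r => /addIr.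
Qed.

Hypothesis exE : exact_courant E.

(* The anchor is onto, so a point with a nonzero tangent vector has a nonzero
   fibre, on which the symbol can be read off. *)
Lemma symbol_unique (X Y : vfield M) :
  (forall f e, fscale (lieD X f) e = fscale (lieD Y f) e) -> X = Y.
Proof.
move=> XY; apply/val_inj/functional_extensionality_dep => x.
apply/val_inj/funext => f; apply/eqP/negPn/negP => ne.
have [_ _ surj] := exE x.
have [v vE] := surj (X x - Y x).
have [e ev] := section_through v.
have /eqP := congr1 (fun s : Gamma E => s x) (XY f e).
rewrite /= -subr_eq0 -scalerBl scaler_eq0 subr_eq0 (negbTE ne) /= ev.
move=> /eqP v0; move: vE; rewrite v0 linear0 => /esym/eqP; rewrite subr_eq0.
by move=> /eqP XYx; case/eqP: ne; exact: (congr1 (fun w : tangent x => w f) XYx).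
Qed.

(** Comparing the two Leibniz rules leaves only the symbol terms, to which [symbol_unique]
    applies. *)
Lemma symb_aop (phi : atiyah E) (X : vfield M) (D : Gamma E -> Gamma E) :
  (forall f e, D (fscale f e) = fscale f (D e) + fscale (lieD X f) e) ->
  aop phi =1 D -> symb phi = X.
Proof.
move=> DX phiD; apply: symbol_unique => f e; apply: (addrI (fscale f (D e))).
by rewrite -DX -!phiD aop_fscale addrC.
Qed.

Lemma atiyah_eq (phi phi' : atiyah E) : aop phi =1 aop phi' -> phi = phi'.
Proof.
move=> e.
have eX : symb phi = symb phi'.
  by apply: symb_aop e => f s; rewrite aop_fscale addrC.
have {e} eD : aop phi = aop phi' by apply/funext.
case: phi phi' eX eD => X D p q r [X' D' p' q' r'] /= eX eD.
by rewrite {X}eX {D}eD in p q r *; congr Atiyah; exact: Prop_irrelevance.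
Qed.

(** Closed by [Defined] so that [symb] and [aop] of it compute. *)
Definition bracket_op e : atiyah E.
Proof.
apply: (@Atiyah _ _ _ (anchor_sec e) (cbr e)).
- exact: (cbr_bilinear E).1.
- by move=> f s; rewrite cbr_fscale addrC.
- by move=> s s'; rewrite cbr_met.
Defined.
End CourantAlgebroid.

(** * The two directions of the equivalence *)

Section Equivalence.
Variables (R : realType) (M : manifold R) (E : courant M) (G : dgla2 R).
Hypotheses (exE : exact_courant E) (exG : exact_dgla G).

Lemma pull_linear (mu : dual_map M (dh G)) : linear (pull mu).
Proof. by move=> k h h'; apply/val_inj/funext => x; rewrite /= linearP. Qed.

Lemma d_form_closed (f : cinf M) : closed_form (d_form f).
Proof. by move=> X Y; apply/val_inj/funext => x; rewrite /= subrr. Qed.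

Lemma extended_of_hamiltonian (phi : dg G -> atiyah E) (mu : dual_map M (dh G))
    (vrho : da G -> Gamma E) :
  hamiltonian_action phi mu vrho ->
  [/\ extended_action vrho (fun u => symb (phi u)),
      momentum_map vrho (fun u => symb (phi u)) mu &
      norm_condition vrho mu].
Proof.
case=> [[lX lD brX brD]] emu lrho erho hvpi hdh hda hcbr; split.
- split=> //.
  + by move=> a b; rewrite erho hda.
  + move=> a; apply/esym/(symb_aop exE (cbr_fscale (vrho a))) => e; exact: hda.
  + by move=> h; exists (d_form (pull mu h)) => //; exact: d_form_closed.
- by split.
- move=> a h ha; have [injh _ _] := exG.
  (* On the diagonal [delta_vpi] reads [delta_h (vpi a a)] = 2 [[a, a]], and [delta_h] is
     injective. *)
  have -> : h = 2^-1 *: vpi a a.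
    apply: injh; rewrite linearZ /= delta_vpi ha -/(abr a a) -[abr a a]scale1r.
    by rewrite -scalerDl scalerA mulVf // pnatr_eq0.
  have := pull_linear mu 2^-1 (vpi a a) 0.
  rewrite !addr0 hvpi => ->.
  have := pull_linear mu (-1) 0 0.
  by rewrite scaler0 addr0 scaleN1r addNr => ->; rewrite addr0.
Qed.

Section HamiltonianOfExtended.
Variables (Psi : da G -> Gamma E) (psi : dg G -> vfield M)
  (mu : dual_map M (dh G)).
Hypotheses (extP : extended_action Psi psi) (momP : momentum_map Psi psi mu)
  (normP : norm_condition Psi mu).

Let PsiD a b : Psi (a + b) = Psi a + Psi b.
Proof. by have := ext_Psi_linear extP 1 a b; rewrite !scale1r. Qed.

Let cbr_Psi a b : delta_a a = delta_a b -> cbr (Psi a) =1 cbr (Psi b).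
Proof.
move=> ab e; have [_ ker _] := exG.
have /ker [h hE] : delta_a (a - b) = 0 by rewrite linearB /= ab subrr.
rewrite -[a](subrK b) PsiD cbrDl -hE (cbr_exact_form _ (mom_rho momP h)).
by rewrite add0r.
Qed.

Let pull_vpi a b : pull mu (vpi a b) = pairing (Psi a) (Psi b).
Proof.
have pullD h h' : pull mu (h + h') = pull mu h + pull mu h'.
  by have := pull_linear mu 1 h h'; rewrite !scale1r.
have vpiDl c d d' : vpi (c + d) d' = vpi c d' + vpi d d' :> dh G.
  by have := (vpi_bilinear G).2 d' 1 c d; rewrite !scale1r.
have diag c : pull mu (vpi c c) = pairing (Psi c) (Psi c).
  have two : (2 : R) != 0 by rewrite pnatr_eq0.
  have E2 : vpi c c = 2^-1 *: vpi c c + 2^-1 *: vpi c c.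
    by rewrite -scalerDl -[X in X + X]mul1r -splitr scale1r.
  (* Half of [vpi c c] is the element of [dh G] that represents [[c, c]]. *)
  have /normP H : delta_h (2^-1 *: vpi c c) = abr c c.
    rewrite linearZ /= delta_vpi -/(abr c c) -[abr c c]scale1r.
    by rewrite -scalerDl scalerA mulVf.
  by rewrite E2 pullD H -scalerDl -[X in X + X]mul1r -splitr scale1r.
have := diag (a + b); rewrite PsiD !pairingDl !pairingDr.
rewrite vpiDl ![vpi _ (a + b)]vpi_sym !vpiDl !pullD !diag.
rewrite (vpi_sym b a) (pairingC (Psi b)) -!addrA => /addrI.
rewrite !addrA => /addIr H.
(* Polarization yields twice the desired equality; the factor 2 is cancelled here. *)
apply/eqP; rewrite -subr_eq0.
rewrite -[X in X == 0](scalerK (_ : (2 : R) != 0)) ?pnatr_eq0 //.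
by rewrite scalerBr !scaler_nat !mulr2n H subrr scaler0.
Qed.

(** Since [delta_a] is onto, each condition is checked on elements [delta_a a]. The commutator and
    derivation rules of [phi] both become the Leibniz identity of [cbr]. *)
Lemma hamiltonian_of_extended : exists phi : dg G -> atiyah E,
  [/\ hamiltonian_action phi mu Psi,
      (forall u, symb (phi u) = psi u) &
      unique (fun phi' : dg G -> atiyah E =>
        forall a e, aop (phi' (delta_a a)) e = cbr (Psi a) e) phi].
Proof.
(* [lift] is a bare choice of preimages; [phi] is nevertheless linear because by [phiE] it does not
   depend on that choice. *)
have [_ _ surj] := exG; have [lift liftK] := choice surj.
pose phi u := bracket_op (Psi (lift u)).
have phiE a e : aop (phi (delta_a a)) e = cbr (Psi a) e by exact: cbr_Psi.
have symbE u : symb (phi u) = psi u by rewrite /= (ext_anchor extP) liftK.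
have psiE : (fun u => symb (phi u)) = psi by apply/funext.
exists phi; split=> //.
- split.
  + split; rewrite ?psiE.
    * exact: ext_psi_linear extP.
    * move=> e k u v; rewrite -(liftK u) -(liftK v) -linearP !phiE.
      by rewrite (ext_Psi_linear extP) (cbr_bilinear E).2.
    * by move=> u v; rewrite !symbE; exact: ext_psi_br extP _ _.
    * move=> u v e; rewrite -(liftK u) -(liftK v) -delta_a_equiv -/(abr _ _) !phiE.
      by rewrite (ext_Psi_br extP) [in RHS]cbr_leibniz addrK.
  + by rewrite psiE; exact: mom_equiv momP.
  + exact: ext_Psi_linear extP.
  + by move=> u a; rewrite -(liftK u) phiE -(ext_Psi_br extP).
  + exact: pull_vpi.
  + exact: mom_rho momP.
  + exact: phiE.
  + by move=> u e1 e2; exact: cbr_leibniz.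
- split=> // phi' phi'E; apply/funext => u; apply: atiyah_eq => // e.
  by rewrite -(liftK u) phiE phi'E.
Qed.
End HamiltonianOfExtended.
End Equivalence.

(** The two passages are mutually inverse: [symb (phi u) = psi u] recovers [psi], and since
    [ham_delta_a] is the property in [unique], a Hamiltonian action gets back its own [phi]. *)
Theorem proposition8p26 (R : realType) (M : manifold R) (E : courant M)
    (G : dgla2 R) (exE : exact_courant E) (exG : exact_dgla G) :
  (forall (phi : dg G -> atiyah E) (mu : dual_map M (dh G))
      (vrho : da G -> Gamma E),
    hamiltonian_action phi mu vrho ->
    [/\ extended_action vrho (fun u => symb (phi u)),
        momentum_map vrho (fun u => symb (phi u)) mu &
        norm_condition vrho mu]) /\
  (forall (Psi : da G -> Gamma E) (psi : dg G -> vfield M)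
      (mu : dual_map M (dh G)),
    extended_action Psi psi -> momentum_map Psi psi mu ->
    norm_condition Psi mu ->
    exists phi : dg G -> atiyah E,
      [/\ hamiltonian_action phi mu Psi,
          (forall u, symb (phi u) = psi u) &
          unique (fun phi' : dg G -> atiyah E =>
            forall a e, aop (phi' (delta_a a)) e = cbr (Psi a) e) phi]).
Proof.
split=> *; first exact: extended_of_hamiltonian.
exact: hamiltonian_of_extended.
Qed.
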